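(* Let $n\ge2$ and let $U\subseteq\{2,\dots,n-1\}$. The Cambrian congruence of $\mathsf{P}(n)$ associated to $U$ is equal to the kernel of the canonical projection $\pi_U\colon\mathsf{P}(n)\twoheadrightarrow\mathsf{A}_U(n)$. Consequently, the Cambrian lattice associated to $U$ is (isomorphic, via $\pi_U$, to) $\mathsf{A}_U(n)$.
   Context: Notation: $[n]=\{1,\dots,n\}$ and $\mathcal{I}_n=\{(i,j)\in[n]\times[n] : i<j\}$. Permutohedra: a subset $\boldsymbol x\subseteq\mathcal{I}_n$ is closed if it is transitive as a binary relation, and clopen if both $\boldsymbol x$ and $\mathcal{I}_n\setminus\boldsymbol x$ are closed. The permutohedron $\mathsf{P}(n)$ is the set of all clopen subsets of $\mathcal{I}_n$, ordered by inclusion; it is a lattice. For $U\subseteq[n]$, $\mathsf{A}_U(n)$ is the set of all subsets $\boldsymbol{a}\subseteq\mathcal{I}_n$ that are transitive as binary relations and such that, whenever $1\le i<j<k\le n$ and $(i,k)\in\boldsymbol{a}$: $(i,j)\in\boldsymbol{a}$ if $j\in U$, and $(j,k)\in\boldsymbol{a}$ if $j\notin U$. It is ordered by inclusion and is a sublattice of $\mathsf{P}(n)$. The map $\pi_U\colon\mathsf{P}(n)\to\mathsf{A}_U(n)$ sends $\boldsymbol x$ to the largest element of $\mathsf{A}_U(n)$ contained in $\boldsymbol x$; it is a surjective lattice homomorphism, and its kernel is the congruence $\{(\boldsymbol x,\boldsymbol y) : \pi_U(\boldsymbol x)=\pi_U(\boldsymbol y)\}$. Cambrian congruences and lattices of type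 A: an orientation of the Dynkin diagram of the symmetric group on $n$ letters is encoded by a subset $U$ of $\{2,3,\dots,n-1\}$. The Cambrian congruence associated to $U$ is the lattice congruence $\eta$ of $\mathsf{P}(n)$ generated by the following pairs, for $1\le i\le n-2$ (permutations being identified with their inversion sets): $$\{(i+1,i+2)\}\equiv\{(i+1,i+2),(i,i+2)\}\pmod\eta\quad\text{if }i+1\in U,$$ $$\{(i,i+1)\}\equiv\{(i,i+1),(i,i+2)\}\pmod\eta\quad\text{if }i+1\notin U.$$ The associated Cambrian lattice is $\mathsf{P}(n)/\eta$. *)

(* Defs.v *)
From HB Require Import structures.
From mathcomp Require Import all_boot all_order.
From mathcomp Require Import zify.

Set Implicit Arguments.
Unset Strict Implicit.
Unset Printing Implicit Defensive.

Import Order.TTheory.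

Local Open Scope order_scope.
Local Open Scope quotient_scope.

(* Congruences of a finite lattice are represented by their graphs.           *)
Section Congruence.

Context {d : Order.disp_t} {L : finLatticeType d}.
Implicit Types (R S : {set L * L}).

Definition is_equivalence R : bool :=
  [&& [forall x, (x, x) \in R],
      [forall x, forall y, ((x, y) \in R) ==> ((y, x) \in R)] &
      [forall x, forall y, forall z,
        ((x, y) \in R) ==> ((y, z) \in R) ==> ((x, z) \in R)]].

Definition is_compatible (op : L -> L -> L) R : bool :=
  [forall x1, forall x2, forall y1, forall y2,
    ((x1, x2) \in R) ==> ((y1, y2) \in R) ==> ((op x1 y1, op x2 y2) \in R)].

Definition is_congruence R : bool :=
  [&& is_equivalence R, is_compatible Order.meet R & is_compatible Order.join R].

Record congruence := Congruence {
  con_graph :> {set L * L};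
  con_graphP : is_congruence con_graph }.

Lemma is_equivalenceP R : reflect
  [/\ forall x, (x, x) \in R,
      forall x y, (x, y) \in R -> (y, x) \in R &
      forall x y z, (x, y) \in R -> (y, z) \in R -> (x, z) \in R]
  (is_equivalence R).
Proof.
apply: (iffP and3P) => -[r s t]; split.
- exact/forallP.
- by move=> x y; move: s => /forallP/(_ x)/forallP/(_ y)/implyP.
- move=> x y z xy yz; move: t => /forallP/(_ x)/forallP/(_ y)/forallP/(_ z).
  by rewrite xy yz.
- exact/forallP.
- by apply/forallP => x; apply/forallP => y; apply/implyP/s.
- apply/forallP => x; apply/forallP => y; apply/forallP => z.
  by apply/implyP => xy; apply/implyP; apply: t xy.
Qed.

Lemma is_compatibleP op R : reflect
  (forall x1 x2 y1 y2, (x1, x2) \in R -> (y1, y2) \in R ->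
     (op x1 y1, op x2 y2) \in R)
  (is_compatible op R).
Proof.
apply: (iffP idP) => [h x1 x2 y1 y2 hx hy|h].
  move: h => /forallP/(_ x1)/forallP/(_ x2)/forallP/(_ y1)/forallP/(_ y2).
  by rewrite hx hy.
apply/forallP => x1; apply/forallP => x2.
apply/forallP => y1; apply/forallP => y2.
by apply/implyP => hx; apply/implyP; apply: h.
Qed.

Definition con_gen_graph S : {set L * L} :=
  \bigcap_(R : {set L * L} | is_congruence R && (S \subset R)) R.

Lemma con_gen_graphP S : is_congruence (con_gen_graph S).
Proof.
apply/and3P; split.
- apply/is_equivalenceP; split.
  + move=> x; apply/bigcapP => R /andP[/and3P[/is_equivalenceP[r _ _] _ _] _].
    exact: r.
  + move=> x y /bigcapP h; apply/bigcapP => R hR; move: (hR) => /andP[].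
    by case/and3P => /is_equivalenceP[_ s _] _ _ _; apply/s/h.
  + move=> x y z /bigcapP h /bigcapP h'.
    apply/bigcapP => R hR; move: (hR) => /andP[].
    by case/and3P => /is_equivalenceP[_ _ t] _ _ _; apply: t (h _ hR) (h' _ hR).
- apply/is_compatibleP => x1 x2 y1 y2 /bigcapP hx /bigcapP hy.
  apply/bigcapP => R hR; move: (hR) => /andP[/and3P[_ /is_compatibleP c _] _].
  exact: c (hx _ hR) (hy _ hR).
- apply/is_compatibleP => x1 x2 y1 y2 /bigcapP hx /bigcapP hy.
  apply/bigcapP => R hR; move: (hR) => /andP[/and3P[_ _ /is_compatibleP c] _].
  exact: c (hx _ hR) (hy _ hR).
Qed.

Definition con_gen S : congruence := Congruence (con_gen_graphP S).

Lemma sub_con_gen S : S \subset con_gen S.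
Proof. by apply/bigcapsP => R /andP[]. Qed.

Lemma con_gen_min S R : is_congruence R -> S \subset R -> con_gen S \subset R.
Proof. by move=> cR sSR; apply: bigcap_inf; rewrite cR. Qed.

Lemma con_refl (C : congruence) x : (x, x) \in con_graph C.
Proof. by case: C => R /= /and3P[/is_equivalenceP[r _ _] _ _]; apply: r. Qed.

Lemma con_sym (C : congruence) x y :
  (x, y) \in con_graph C -> (y, x) \in con_graph C.
Proof. by case: C => R /= /and3P[/is_equivalenceP[_ s _] _ _]; apply: s. Qed.

Lemma con_trans (C : congruence) x y z : (x, y) \in con_graph C ->
  (y, z) \in con_graph C -> (x, z) \in con_graph C.
Proof. by case: C => R /= /and3P[/is_equivalenceP[_ _ t] _ _]; apply: t. Qed.

Lemma con_meet (C : congruence) x1 x2 y1 y2 : (x1, x2) \in con_graph C ->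
  (y1, y2) \in con_graph C -> (x1 `&` y1, x2 `&` y2) \in con_graph C.
Proof. by case: C => R /= /and3P[_ /is_compatibleP c _]; apply: c. Qed.

Lemma con_join (C : congruence) x1 x2 y1 y2 : (x1, x2) \in con_graph C ->
  (y1, y2) \in con_graph C -> (x1 `|` y1, x2 `|` y2) \in con_graph C.
Proof. by case: C => R /= /and3P[_ _ /is_compatibleP c]; apply: c. Qed.

Definition con_rel (C : congruence) : rel L :=
  fun x y => (x, y) \in con_graph C.

Lemma con_rel_sym C : symmetric (con_rel C).
Proof. by move=> x y; apply/idP/idP; apply: con_sym. Qed.

Lemma con_rel_trans C : transitive (con_rel C).
Proof. by move=> y x z; apply: con_trans. Qed.

Canonical con_equiv (C : congruence) :=
  EquivRel (con_rel C) (@con_refl C) (@con_rel_sym C) (@con_rel_trans C).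

Definition quotient_lattice (C : congruence) : Type := {eq_quot (con_equiv C)}.

End Congruence.
Arguments congruence {d} L.

Fact quotient_display (d : Order.disp_t) : Order.disp_t.
Proof. exact: d. Qed.

Section QuotientLattice.

Context {d : Order.disp_t} {L : finLatticeType d} (C : congruence L).
Notation Q := (quotient_lattice C).

HB.instance Definition _ := EqQuotient.on Q.
HB.instance Definition _ := Choice.on Q.

Definition quo_meet (a b : Q) : Q := \pi_Q (repr a `&` repr b).
Definition quo_join (a b : Q) : Q := \pi_Q (repr a `|` repr b).
Definition quo_le (a b : Q) : bool := quo_meet a b == a.

Lemma quo_eqP (x y : L) :
  reflect (\pi_Q x = \pi_Q y) ((x, y) \in con_graph C).
Proof. exact: (@eqquotP _ (con_equiv C)). Qed.

Lemma con_repr (x : L) : (repr (\pi_Q x), x) \in con_graph C.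
Proof. by apply/quo_eqP; rewrite reprK. Qed.

Lemma quo_meetE x y : quo_meet (\pi x) (\pi y) = \pi_Q (x `&` y).
Proof. by apply/quo_eqP/con_meet; apply: con_repr. Qed.

Lemma quo_joinE x y : quo_join (\pi x) (\pi y) = \pi_Q (x `|` y).
Proof. by apply/quo_eqP/con_join; apply: con_repr. Qed.

Lemma quo_meetC : commutative quo_meet.
Proof.
by elim/quotW => x; elim/quotW => y; rewrite !quo_meetE meetC.
Qed.

Lemma quo_joinC : commutative quo_join.
Proof.
by elim/quotW => x; elim/quotW => y; rewrite !quo_joinE joinC.
Qed.

Lemma quo_meetA : associative quo_meet.
Proof.
by elim/quotW=> x; elim/quotW=> y; elim/quotW=> z; rewrite !quo_meetE meetA.
Qed.

Lemma quo_joinA : associative quo_join.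
Proof.
by elim/quotW=> x; elim/quotW=> y; elim/quotW=> z; rewrite !quo_joinE joinA.
Qed.

Lemma quo_meetxx : idempotent_op quo_meet.
Proof. by elim/quotW => x; rewrite quo_meetE meetxx. Qed.

Lemma quo_joinKI y x : quo_meet x (quo_join x y) = x.
Proof.
by elim/quotW: x => x; elim/quotW: y => y; rewrite quo_joinE quo_meetE joinKI.
Qed.

Lemma quo_meetKU y x : quo_join x (quo_meet x y) = x.
Proof.
by elim/quotW: x => x; elim/quotW: y => y; rewrite quo_meetE quo_joinE meetKU.
Qed.

Lemma quo_le_refl : reflexive quo_le.
Proof. by move=> a; rewrite /quo_le quo_meetxx. Qed.

Lemma quo_le_anti : antisymmetric quo_le.
Proof. by move=> a b /andP[/eqP ab /eqP ba]; rewrite -ab quo_meetC. Qed.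

Lemma quo_le_trans : transitive quo_le.
Proof.
by move=> b a c /eqP ab /eqP bc; rewrite /quo_le -ab -quo_meetA bc.
Qed.

HB.instance Definition _ := Order.Le_isPOrder.Build (quotient_display d) Q
  quo_le_refl quo_le_anti quo_le_trans.

HB.instance Definition _ := Order.POrder_isLattice.Build (quotient_display d) Q
  quo_meetC quo_joinC quo_meetA quo_joinA quo_joinKI quo_meetKU
  (fun _ _ => erefl).

End QuotientLattice.

(* The ordinal i : 'I_n stands for the element i + 1 of {1, ..., n}.          *)
Section Permutohedron.

Context {n : nat}.
Implicit Types (a x : {set 'I_n * 'I_n}).

Definition inc_pairs : {set 'I_n * 'I_n} := [set p : 'I_n * 'I_n | (p.1 < p.2)%N].

Definition is_closed a : bool :=
  [forall i, forall j, forall k,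
    ((i, j) \in a) ==> ((j, k) \in a) ==> ((i, k) \in a)].

Definition is_clopen x : bool :=
  [&& x \subset inc_pairs, is_closed x & is_closed (inc_pairs :\: x)].

Lemma is_closedP a : reflect
  (forall i j k, (i, j) \in a -> (j, k) \in a -> (i, k) \in a) (is_closed a).
Proof.
apply: (iffP idP) => [h i j k ij jk|h].
  by move: h => /forallP/(_ i)/forallP/(_ j)/forallP/(_ k); rewrite ij jk.
apply/forallP => i; apply/forallP => j; apply/forallP => k.
by apply/implyP => ij; apply/implyP; apply: h ij.
Qed.

Lemma is_clopenP x : reflect
  [/\ forall i j, (i, j) \in x -> (i < j)%N,
      forall i j k, (i, j) \in x -> (j, k) \in x -> (i, k) \in x &
      forall i j k : 'I_n, (i < j < k)%N -> (i, k) \in x ->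
        ((i, j) \in x) || ((j, k) \in x)]
  (is_clopen x).
Proof.
apply: (iffP and3P) => [[sx /is_closedP cx /is_closedP ox]|[sx cx ox]].
  split=> // [i j /(subsetP sx)|i j k /andP[ij jk] ik]; first by rewrite inE.
  apply/negPn; rewrite negb_or; apply/negP => /andP[nij njk].
  by have := ox i j k; rewrite !inE nij njk ij jk ik => /(_ isT isT).
split; [|exact/is_closedP|].
  by apply/subsetP => -[i j] /sx; rewrite inE.
apply/is_closedP => i j k; rewrite !inE /= => /andP[nij ij] /andP[njk jk].
rewrite (ltn_trans ij jk) andbT; apply/negP => ik.
by have := ox i j k; rewrite ij jk (negPf nij) (negPf njk) => /(_ isT ik).
Qed.

Definition trans_closure a : {set 'I_n * 'I_n} :=
  [set p in inc_pairs | connect (fun i j => (i, j) \in a) p.1 p.2].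

Section TransClosure.
Variable a : {set 'I_n * 'I_n}.
Hypothesis sa : forall i j, (i, j) \in a -> (i < j)%N.
Let r i j := (i, j) \in a.

Lemma trans_closureE i j :
  ((i, j) \in trans_closure a) = (i < j)%N && connect r i j.
Proof. by rewrite !inE. Qed.

Lemma sub_trans_closure i j : (i, j) \in a -> (i, j) \in trans_closure a.
Proof. by move=> aij; rewrite trans_closureE sa // connect1. Qed.

Lemma trans_closure_trans i j k : (i, j) \in trans_closure a ->
  (j, k) \in trans_closure a -> (i, k) \in trans_closure a.
Proof.
rewrite !trans_closureE => /andP[ij cij] /andP[jk cjk].
by rewrite (ltn_trans ij jk) (connect_trans cij cjk).
Qed.

Lemma trans_closure_ind (P : 'I_n -> 'I_n -> Prop) :
  (forall i j, (i, j) \in a -> P i j) ->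
  (forall i j k, (i, j) \in a -> (j, k) \in trans_closure a -> P j k -> P i k) ->
  forall i j, (i, j) \in trans_closure a -> P i j.
Proof.
move=> P1 PS i j; rewrite trans_closureE => /andP[ij /connectP[p]].
elim: p i ij => [|z p IHp] i ij /=; first by move=> _ ji; rewrite ji ltnn in ij.
case/andP => iz zp lp.
have [zj|] := ltnP z j.
  apply: PS (iz) _ (IHp z zj zp lp); rewrite trans_closureE zj.
  by apply/connectP; exists p.
case: p zp lp {IHp} => [|y p] /= zp lp jz; first by rewrite lp; apply: P1.
have zj : (z < j)%N.
  rewrite lp; move: zp => /andP[/sa zy]; elim: p y zy {lp} => //= w p IHp y zy.
  by case/andP => /sa yw; apply: IHp; apply: ltn_trans yw.
by rewrite ltnNge jz in zj.
Qed.

Lemma trans_closure_min x :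
  (forall i j k, (i, j) \in x -> (j, k) \in x -> (i, k) \in x) ->
  (trans_closure a \subset x) = (a \subset x).
Proof.
move=> tx; apply/subsetP/subsetP => h [i j].
  by move/sub_trans_closure; apply: h.
apply: (trans_closure_ind (P := fun i j => (i, j) \in x)) => [i' j'|i' j' k' ij _].
  exact: h.
by apply: tx; apply: h.
Qed.

Lemma trans_closure_left (U : {pred 'I_n}) :
  (forall i j k : 'I_n, (i < j < k)%N -> (i, k) \in a -> j \in U ->
    (i, j) \in a) ->
  forall i j k : 'I_n, (i < j < k)%N -> (i, k) \in trans_closure a -> j \in U ->
    (i, j) \in trans_closure a.
Proof.
move=> la i j k /[swap] ik; move: i k ik j.
apply: trans_closure_ind => [i k ik j ijk jU|i z k iz zk IH j /andP[ij jk] jU].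
  exact/sub_trans_closure/(la i j k).
case: (ltngtP j z) => [jz|zj|/ord_inj->]; last exact: sub_trans_closure.
  by apply/sub_trans_closure/(la i j z); rewrite ?ij.
by apply: trans_closure_trans (sub_trans_closure iz) _; apply: IH; rewrite ?zj.
Qed.

Lemma trans_closure_right (U : {pred 'I_n}) :
  (forall i j k : 'I_n, (i < j < k)%N -> (i, k) \in a -> j \in U ->
    (j, k) \in a) ->
  forall i j k : 'I_n, (i < j < k)%N -> (i, k) \in trans_closure a -> j \in U ->
    (j, k) \in trans_closure a.
Proof.
move=> ra i j k /[swap] ik; move: i k ik j.
apply: trans_closure_ind => [i k ik j ijk jU|i z k iz zk IH j /andP[ij jk] jU].
  exact/sub_trans_closure/(ra i j k).
case: (ltngtP j z) => [jz|zj|/ord_inj->//].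
  apply: trans_closure_trans zk; apply/sub_trans_closure/(ra i j z) => //.
  by rewrite ij.
by apply: IH; rewrite ?zj.
Qed.

Lemma trans_closure_open :
  (forall i j k : 'I_n, (i < j < k)%N -> (i, k) \in a ->
    ((i, j) \in a) || ((j, k) \in a)) ->
  forall i j k : 'I_n, (i < j < k)%N -> (i, k) \in trans_closure a ->
    ((i, j) \in trans_closure a) || ((j, k) \in trans_closure a).
Proof.
move=> oa i j k /[swap] ik; move: i k ik j.
apply: trans_closure_ind => [i k ik j ijk|i z k iz zk IH j /andP[ij jk]].
  by case/orP: (oa i j k ijk ik) => /sub_trans_closure-> //; rewrite orbT.
case: (ltngtP j z) => [jz|zj|/ord_inj->]; last by rewrite sub_trans_closure.
  have /orP[/sub_trans_closure->//|jz'] : ((i, j) \in a) || ((j, z) \in a).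
    by apply: oa; rewrite ?ij.
  by rewrite (trans_closure_trans (sub_trans_closure jz') zk) orbT.
have /orP[zj'|->] := IH j (introT andP (conj zj jk)); last by rewrite orbT.
by rewrite (trans_closure_trans (sub_trans_closure iz) zj').
Qed.

End TransClosure.

End Permutohedron.
Arguments inc_pairs n : clear implicits.

Record permutohedron (n : nat) := Permutohedron {
  inversions :> {set 'I_n * 'I_n};
  inversionsP : is_clopen inversions }.

HB.instance Definition _ n := [isSub for @inversions n].
HB.instance Definition _ n := [Finite of permutohedron n by <:].

Fact permutohedron_display : Order.disp_t.
Proof. exact: Order.Disp tt tt. Qed.

Section PermutohedronLattice.

Context {n : nat}.
Implicit Types x y z : permutohedron n.

Definition perm_le x y : bool := inversions x \subset inversions y.

Lemma perm_le_refl : reflexive perm_le.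
Proof. by move=> x; apply: subxx. Qed.

Lemma perm_le_anti : antisymmetric perm_le.
Proof. by move=> x y h; apply/val_inj/eqP; rewrite eqEsubset. Qed.

Lemma perm_le_trans : transitive perm_le.
Proof. by move=> y x z; apply: subset_trans. Qed.

HB.instance Definition _ := Order.Le_isPOrder.Build permutohedron_display
  (permutohedron n) perm_le_refl perm_le_anti perm_le_trans.

Lemma perm_setU_lt x y i j :
  (i, j) \in inversions x :|: inversions y -> (i < j)%N.
Proof.
have /is_clopenP[sx _ _] := inversionsP x.
have /is_clopenP[sy _ _] := inversionsP y.
by rewrite inE => /orP[/sx|/sy].
Qed.

Lemma perm_compl_subproof x : is_clopen (inc_pairs n :\: inversions x).
Proof.
have /and3P[sx cx ox] := inversionsP x; apply/and3P; split=> //.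
  exact: subsetDl.
by rewrite setDDr setDv set0U (setIidPr sx).
Qed.
Definition perm_compl x := Permutohedron (perm_compl_subproof x).

Lemma perm_complK : involutive perm_compl.
Proof.
move=> x; apply/val_inj; rewrite /= setDDr setDv set0U; apply/setIidPr.
by have /and3P[] := inversionsP x.
Qed.

Lemma perm_le_compl x y : perm_le (perm_compl x) (perm_compl y) = perm_le y x.
Proof.
have h u v : perm_le v u -> perm_le (perm_compl u) (perm_compl v).
  exact: setDS.
by apply/idP/idP => /h //; rewrite !perm_complK.
Qed.

Lemma perm_join_subproof x y :
  is_clopen (trans_closure (inversions x :|: inversions y)).
Proof.
have slt := @perm_setU_lt x y.
apply/is_clopenP; split.
- by move=> i j; rewrite trans_closureE => /andP[].
- exact: trans_closure_trans.
- apply: trans_closure_open => // i j k ijk.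
  have /is_clopenP[_ _ ox] := inversionsP x.
  have /is_clopenP[_ _ oy] := inversionsP y.
  rewrite !inE => /orP[/(ox i j k ijk)|/(oy i j k ijk)].
    by case/orP=> ->; rewrite ?orbT.
  by case/orP=> ->; rewrite ?orbT.
Qed.
Definition perm_join x y := Permutohedron (perm_join_subproof x y).
Definition perm_meet x y := perm_compl (perm_join (perm_compl x) (perm_compl y)).

Lemma perm_joinP x y z :
  perm_le (perm_join x y) z = perm_le x z && perm_le y z.
Proof.
rewrite /perm_le -subUset; apply: trans_closure_min; first exact: perm_setU_lt.
by have /is_clopenP[] := inversionsP z.
Qed.

Lemma perm_meetP x y z :
  perm_le x (perm_meet y z) = perm_le x y && perm_le x z.
Proof.
by rewrite -{1}[x]perm_complK perm_le_compl perm_joinP !perm_le_compl.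
Qed.

HB.instance Definition _ := Order.POrder_MeetJoin_isLattice.Build
  permutohedron_display (permutohedron n) perm_meetP perm_joinP.

End PermutohedronLattice.

Section Cambrian.

Context {n : nat} (U : {set 'I_n}).
Implicit Types (a : {set 'I_n * 'I_n}).

Definition in_A a : bool :=
  [&& a \subset inc_pairs n, is_closed a &
    [forall i : 'I_n, forall j : 'I_n, forall k : 'I_n,
      [&& (i < j)%N, (j < k)%N & (i, k) \in a] ==>
      if j \in U then (i, j) \in a else (j, k) \in a]].

Lemma in_AP a : reflect
  [/\ forall i j, (i, j) \in a -> (i < j)%N,
      forall i j k, (i, j) \in a -> (j, k) \in a -> (i, k) \in a,
      forall i j k : 'I_n, (i < j < k)%N -> (i, k) \in a -> j \in U ->
        (i, j) \in a &
      forall i j k : 'I_n, (i < j < k)%N -> (i, k) \in a -> j \in ~: U ->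
        (j, k) \in a]
  (in_A a).
Proof.
apply: (iffP and3P) => [[sa /is_closedP ca h]|[sa ca la ra]].
  have {}h (i j k : 'I_n) : (i < j < k)%N -> (i, k) \in a ->
      if j \in U then (i, j) \in a else (j, k) \in a.
    move=> /andP[ij jk] ik.
    move: h => /forallP/(_ i)/forallP/(_ j)/forallP/(_ k).
    by rewrite ij jk ik.
  split=> // [i j /(subsetP sa)|i j k /h{}h /h + jU|i j k /h{}h /h].
  - by rewrite inE.
  - by rewrite jU.
  - by rewrite inE; case: ifP.
split.
- by apply/subsetP => -[i j] /sa; rewrite inE.
- exact/is_closedP.
- apply/forallP => i; apply/forallP => j; apply/forallP => k.
  apply/implyP => /and3P[ij jk ik]; have ijk := introT andP (conj ij jk).
  by case: ifP => jU; [apply: la ijk _ _|apply: ra ijk _ _; rewrite ?inE ?jU].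
Qed.

Record camb_A := CambA { camb_set :> {set 'I_n * 'I_n}; camb_setP : in_A camb_set }.

HB.instance Definition _ := [isSub for camb_set].
HB.instance Definition _ := [Finite of camb_A by <:].

End Cambrian.
Arguments camb_A n U : clear implicits.

Fact camb_display : Order.disp_t.
Proof. exact: Order.Disp tt tt. Qed.

Section CambrianLattice.

Context {n : nat} {U : {set 'I_n}}.
Implicit Types a b c : camb_A n U.

Definition camb_le a b : bool := camb_set a \subset camb_set b.

Lemma camb_le_refl : reflexive camb_le.
Proof. by move=> a; apply: subxx. Qed.

Lemma camb_le_anti : antisymmetric camb_le.
Proof. by move=> a b h; apply/val_inj/eqP; rewrite eqEsubset. Qed.

Lemma camb_le_trans : transitive camb_le.
Proof. by move=> b a c; apply: subset_trans. Qed.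

HB.instance Definition _ := Order.Le_isPOrder.Build camb_display
  (camb_A n U) camb_le_refl camb_le_anti camb_le_trans.

Lemma camb_meet_subproof a b : in_A U (camb_set a :&: camb_set b).
Proof.
have /in_AP[sa ca la ra] := camb_setP a.
have /in_AP[_ cb lb rb] := camb_setP b.
apply/in_AP; split.
- by move=> i j; rewrite inE => /andP[/sa].
- move=> i j k; rewrite !inE => /andP[aij bij] /andP[ajk bjk].
  by rewrite (ca i j k) ?(cb i j k).
- move=> i j k ijk; rewrite !inE => /andP[aik bik] jU.
  by rewrite (la i j k) ?(lb i j k).
- move=> i j k ijk /[!in_setI] /andP[aik bik] jU.
  by rewrite (ra i j k) ?(rb i j k).
Qed.
Definition camb_meet a b := CambA (camb_meet_subproof a b).

Lemma camb_setU_lt a b i j : (i, j) \in camb_set a :|: camb_set b -> (i < j)%N.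
Proof.
have /in_AP[sa _ _ _] := camb_setP a; have /in_AP[sb _ _ _] := camb_setP b.
by rewrite inE => /orP[/sa|/sb].
Qed.

Lemma camb_join_subproof a b :
  in_A U (trans_closure (camb_set a :|: camb_set b)).
Proof.
have slt := @camb_setU_lt a b.
have /in_AP[sa ca la ra] := camb_setP a.
have /in_AP[_ cb lb rb] := camb_setP b.
apply/in_AP; split.
- by move=> i j; rewrite trans_closureE => /andP[].
- exact: trans_closure_trans.
- apply: trans_closure_left => // i j k ijk /setUP[/(la i j k ijk) h|].
    by move/h; rewrite inE => ->.
  by move=> /(lb i j k ijk) h /h; rewrite inE orbC => ->.
- apply: trans_closure_right => // i j k ijk /setUP[/(ra i j k ijk) h|].
    by move/h; rewrite inE => ->.
  by move=> /(rb i j k ijk) h /h; rewrite inE orbC => ->.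
Qed.
Definition camb_join a b := CambA (camb_join_subproof a b).

Lemma camb_meetP a b c : camb_le a (camb_meet b c) = camb_le a b && camb_le a c.
Proof. exact: subsetI. Qed.

Lemma camb_joinP a b c : camb_le (camb_join a b) c = camb_le a c && camb_le b c.
Proof.
rewrite /camb_le -subUset; apply: trans_closure_min; first exact: camb_setU_lt.
by have /in_AP[] := camb_setP c.
Qed.

HB.instance Definition _ := Order.POrder_MeetJoin_isLattice.Build
  camb_display (camb_A n U) camb_meetP camb_joinP.

End CambrianLattice.

Section Projection.

Context {n : nat} (U : {set 'I_n}).
Implicit Types (x : permutohedron n) (a b : camb_A n U).

Definition is_largest_below x a : bool :=
  (camb_set a \subset inversions x) &&
  [forall b : camb_A n U, (camb_set b \subset inversions x) ==> (b <= a)].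

Lemma camb_bot_subproof : in_A U set0.
Proof. by apply/in_AP; split=> [i j|i j k|i j k _|i j k _]; rewrite inE. Qed.

Lemma exists_largest_below x : exists a, is_largest_below x a.
Proof.
pose a := \big[Order.join/CambA camb_bot_subproof]_
            (b : camb_A n U | camb_set b \subset inversions x) b.
exists a; apply/andP; split; last first.
  apply/forallP => b; apply/implyP => bx.
  by rewrite /a (bigD1 b) //= leUl.
rewrite /a; elim/big_ind: _ => //= [|b c bx cx]; first exact: sub0set.
rewrite trans_closure_min ?subUset ?bx //; first exact: camb_setU_lt.
by have /is_clopenP[] := inversionsP x.
Qed.

Definition pi_U x : camb_A n U := xchoose (exists_largest_below x).

Lemma pi_U_largest x : is_largest_below x (pi_U x).
Proof. exact: xchooseP. Qed.

Definition kernel {T S : finType} (f : T -> S) : {set T * T} :=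
  [set p | f p.1 == f p.2].

(* With j = i + 1 and k = i + 2, these are the pairs                          *)
(*   {(j, k)} == {(j, k), (i, k)}  when j is in U, and                        *)
(*   {(i, j)} == {(i, j), (i, k)}  otherwise.                                 *)
(* All four sets are clopen, see clopen_gen below.                            *)
Definition cambrian_pairs : {set permutohedron n * permutohedron n} :=
  [set p | [exists i : 'I_n, exists j : 'I_n, exists k : 'I_n,
    [&& j == i.+1 :> nat, k == i.+2 :> nat &
      if j \in U then
        (inversions p.1 == [set (j, k)]) &&
        (inversions p.2 == [set (j, k); (i, k)])
      else
        (inversions p.1 == [set (i, j)]) &&
        (inversions p.2 == [set (i, j); (i, k)])]]].

Lemma clopen_gen (i j k : 'I_n) : j = i.+1 :> nat -> k = i.+2 :> nat ->
  [/\ is_clopen [set (j, k)], is_clopen [set (j, k); (i, k)],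
      is_clopen [set (i, j)] & is_clopen [set (i, j); (i, k)]].
Proof.
move=> ji ki.
split; apply/is_clopenP; split=> [a b|a b c|a b c].
all: by rewrite !inE !xpair_eqE -!val_eqE /=; lia.
Qed.

Definition cambrian_congruence : congruence (permutohedron n) :=
  con_gen cambrian_pairs.

Definition cambrian_lattice := quotient_lattice cambrian_congruence.

HB.instance Definition _ := Order.Lattice.on cambrian_lattice.

End Projection.

(* Main.v *)
(* The projection [pi_U] is right adjoint to the inclusion of A_U(n) in P(n), hence
   preserves meets. Complementation exchanges the roles of U and ~U, and the
   complement of pi_{~U} of the complement of x is the top of the fibre of [pi_U]
   through x; since this top is monotone in x, joins are preserved as well, so the
   kernel is a congruence, and it contains the generating pairs.
   Conversely, each x is shown to be Cambrian-congruent to pi_U(x). Let m be the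
   largest element congruent to pi_U(x), and show (a, b) \in m for (a, b) \in x by
   induction on b - a. The join-irreducible arc from a to b given by
   S = {j | (a, j) \in x} lies below x. If S agrees with U strictly between a and b,
   this arc lies below pi_U(x). Otherwise some j strictly between a and b separates
   S from U; the generating pair at (j - 1, j, j + 1) contracts the arc from j - 1 to
   j + 1, which forces the contraction of the arc from a to b onto its lower cover,
   and this lower cover is below m by induction. *)
Require Import Defs.
From HB Require Import structures.
From mathcomp Require Import all_boot all_order.
From mathcomp Require Import zify.

Set Implicit Arguments.
Unset Strict Implicit.
Unset Printing Implicit Defensive.

Import Order.TTheory.

Local Open Scope quotient_scope.

(* Elaborated types of sets of ordinals may differ by [reverse_coercion], which
   would make [lia] see different atoms in [j \in S]. *)
Ltac setlia := unfold reverse_coercion in *; lia.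

(** * Convexity and largest elements of congruence classes *)

Section CongruenceClasses.

Context {d : Order.disp_t} {L : finLatticeType d} (C : congruence L).
Implicit Types x y z : L.
Local Open Scope order_scope.

Lemma con_convex x y z : x <= y -> y <= z -> (x, z) \in con_graph C ->
  (x, y) \in con_graph C.
Proof.
move=> xy yz xz; have := con_meet xz (con_refl C y).
by rewrite (meet_l xy) (meet_r yz).
Qed.

Lemma con_class_max x :
  exists2 m, (x, m) \in con_graph C & forall y, (x, y) \in con_graph C -> y <= m.
Proof.
exists (\big[Order.join/x]_(y | (x, y) \in con_graph C) y); last first.
  by move=> y xy; rewrite (bigD1 y) //= leUl.
elim/big_ind: _ => // [|y z xy xz]; first exact: con_refl.
by rewrite -[x in (x, _)]joinxx; apply: con_join.
Qed.

End CongruenceClasses.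

Lemma perm_leE n (x y : permutohedron n) :
  (x <= y)%O = (inversions x \subset inversions y).
Proof. by []. Qed.

Lemma camb_leE n (U : {set 'I_n}) (a b : camb_A n U) :
  (a <= b)%O = (camb_set a \subset camb_set b).
Proof. by []. Qed.

Lemma inversions_trans n (x : permutohedron n) i j k :
  (i, j) \in inversions x -> (j, k) \in inversions x -> (i, k) \in inversions x.
Proof. by have /is_clopenP[_ + _] := inversionsP x; apply. Qed.

(** * Arcs in the permutohedron *)

Section Arcs.

Context {n : nat}.
Implicit Types (a b i j k p q : 'I_n) (S U : {set 'I_n}) (x y : permutohedron n).

(* For a < b, [arc a b U] is the least element of A_U(n) containing (a, b); when S
   ranges over all sets, the [arc a b S] are the join-irreducible elements of P(n), and
   [arc_low a b S] is the unique lower cover of [arc a b S]. *)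
Definition arc_set a b S : {set 'I_n * 'I_n} :=
  [set p : 'I_n * 'I_n | [&& a <= p.1, p.1 < p.2, p.2 <= b,
     (p.1 == a) || (p.1 \notin S) & (p.2 == b) || (p.2 \in S)]].

Lemma in_arc a b S p q : ((p, q) \in arc_set a b S) =
  [&& a <= p, p < q, q <= b, (p == a :> nat) || (p \notin S)
    & (q == b :> nat) || (q \in S)].
Proof. by rewrite inE. Qed.

Lemma arc_clopen a b S : is_clopen (arc_set a b S).
Proof.
apply/is_clopenP; split=> [i j|i j k|i j k]; rewrite !in_arc; setlia.
Qed.

Lemma arc_low_clopen a b S : is_clopen (arc_set a b S :\ (a, b)).
Proof.
by apply/is_clopenP; split=> [i j|i j k|i j k];
  rewrite !in_setD1 !in_arc !xpair_eqE -!val_eqE /=; setlia.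
Qed.

Definition arc a b S := Permutohedron (arc_clopen a b S).
Definition arc_low a b S := Permutohedron (arc_low_clopen a b S).

Lemma arc_low_le a b S : (arc_low a b S <= arc a b S)%O.
Proof. exact: subsetDl. Qed.

(** For (p, q) in the arc, (a, q) lies in x because q is b or in S. If p is not a, then p is not in
    S, so (a, p) is not in x and openness of x yields (p, q). *)
Lemma arc_sub x a b S : (a, b) \in inversions x ->
  (forall j, a < j < b -> (j \in S) = ((a, j) \in inversions x)) ->
  arc_set a b S \subset inversions x.
Proof.
have /is_clopenP[_ _ ox] := inversionsP x.
move=> ab Sx; apply/subsetP => -[p q]; rewrite in_arc => /and5P[ap pq qb pS qS].
have aq : (a, q) \in inversions x.
  move: qS; case: eqP => [/ord_inj-> //|/= qb' qS].
  by rewrite -Sx //; setlia.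
move: pS; case: eqP => [/ord_inj-> //|/= pa pS].
have apq : a < p < q by setlia.
by case/orP: (ox _ _ _ apq aq) => //; rewrite -Sx ?(negPf pS) //; setlia.
Qed.

End Arcs.

(** * Forcing: contracting an arc contracts the longer arcs with the same S *)

Section ArcContraction.

Context {n : nat} (C : congruence (permutohedron n)) (S : {set 'I_n}).
Variables a' a b b' : 'I_n.
Hypotheses (aa : a' <= a) (ab : a < b) (bb : b <= b').

(* [bypass] complements the arc from a to b: joined with [arc a b S] it lies
   above [arc a' b' S], but joined with [arc_low a b S] it misses (a', b'). *)
Let bypass_set : {set 'I_n * 'I_n} :=
  [set p : 'I_n * 'I_n | [&& a' <= p.1, p.1 < p.2, p.2 <= b',
     [|| p.1 == a' :> nat, p.1 == b :> nat | p.1 \notin S],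
     [|| p.2 == b' :> nat, p.2 == a :> nat | p.2 \in S]
     & ~~ ((p.1 <= a) && (b <= p.2))]].

Let in_bypass p q : ((p, q) \in bypass_set) =
  [&& a' <= p, p < q, q <= b',
     [|| p == a' :> nat, p == b :> nat | p \notin S],
     [|| q == b' :> nat, q == a :> nat | q \in S]
     & ~~ ((p <= a) && (b <= q))].
Proof. by rewrite inE. Qed.

Lemma bypass_clopen : is_clopen bypass_set.
Proof.
by apply/is_clopenP; split=> [i j|i j k|i j k]; rewrite !in_bypass; setlia.
Qed.

Let bypass := Permutohedron bypass_clopen.

(** A pair (p, q) with p <= a and b <= q is composed of (p, a), (a, b) and (b, q), the outer two
    taken from [bypass] unless trivial; every other pair of the long arc is already in [bypass]. *)
Lemma arc_le_bypass : (arc a' b' S <= arc a b S `|` bypass)%O.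
Proof.
set x := (_ `|` _)%O.
have Jx : (arc a b S <= x)%O by apply: leUl.
have /subsetP Kx : (bypass <= x)%O by apply: leUr.
have xab : (a, b) \in inversions x.
  by apply: (subsetP Jx); rewrite in_arc; setlia.
apply/subsetP => -[p q]; rewrite in_arc => pq.
have [/andP[pa bq]|far] := boolP ((p <= a) && (b <= q)); last first.
  by apply: Kx; rewrite in_bypass; setlia.
have xpb : (p, b) \in inversions x.
  have [/ord_inj-> //|npa] := eqVneq (p : nat) a.
  by apply: inversions_trans xab; apply: Kx; rewrite in_bypass; setlia.
have [/ord_inj-> //|nqb] := eqVneq (q : nat) b.
by apply: inversions_trans xpb _; apply: Kx; rewrite in_bypass; setlia.
Qed.

Lemma bypass_avoid : (a', b') \notin inversions (arc_low a b S `|` bypass)%O.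
Proof.
(* In [W], a pair starting at or below a ends at or below a, or at an element of S strictly between
   a and b, where no pair of [W] starts. Hence [W] is transitive, and it misses (a', b'). *)
pose W : {set 'I_n * 'I_n} := [set p : 'I_n * 'I_n |
  ~~ [&& a < p.1, p.1 < b & p.1 \in S] &&
  ((p.1 <= a) ==> (p.2 <= a) || [&& a < p.2, p.2 < b & p.2 \in S])].
have /subsetP sW : inversions (arc_low a b S `|` bypass)%O \subset W.
  rewrite trans_closure_min; last 2 first.
  - exact: perm_setU_lt.
  - by move=> i j k; rewrite !inE /=; setlia.
  apply/subsetP => -[p q]; rewrite in_setU in_setD1 in_arc in_bypass.
  by rewrite xpair_eqE -!val_eqE inE /=; setlia.
by apply/negP => /sW; rewrite !inE /=; setlia.
Qed.

(** Join the given congruence with [bypass], meet with the long arc, then join with its lower cover: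
    the two sides become that cover and the long arc. *)
Lemma arc_contract : (arc_low a b S, arc a b S) \in con_graph C ->
  (arc_low a' b' S, arc a' b' S) \in con_graph C.
Proof.
move=> J; have := con_meet (con_refl C (arc a' b' S)) (con_join J (con_refl C bypass)).
move/(con_join (con_refl C (arc_low a' b' S))).
rewrite (meet_l arc_le_bypass) (join_r (arc_low_le _ _ _)) join_l //.
set z := (_ `|` _)%O.
have zl : (arc a' b' S `&` z <= arc a' b' S)%O by apply: leIl.
have zr : (arc a' b' S `&` z <= z)%O by apply: leIr.
rewrite perm_leE subsetD1; apply/andP; split; first exact: zl.
by apply: contra bypass_avoid; apply: (subsetP zr).
Qed.

End ArcContraction.

(** * The projection [pi_U] as a lattice homomorphism *)

Section Projection.

Context {n : nat}.
Implicit Types (U S : {set 'I_n}) (x y : permutohedron n).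

Lemma pi_set_in_A U x : in_A U [set p : 'I_n * 'I_n |
  (p.1 < p.2) && (arc_set p.1 p.2 U \subset inversions x)].
Proof.
apply/in_AP; split=> [i j|i j k|i j k ijk|i j k ijk]; rewrite !inE /=.
- by case/andP.
- move=> /andP[ij /subsetP sij] /andP[jk /subsetP sjk]; apply/andP; split.
    exact: ltn_trans jk.
  apply/subsetP => -[p q]; rewrite in_arc => pq.
  have [qj|jq] := leqP q j; first by apply: sij; rewrite in_arc; setlia.
  have [jp|pj] := leqP j p; first by apply: sjk; rewrite in_arc; setlia.
  (* A pair straddling j factors through j, an endpoint of both arcs. *)
  apply: (@inversions_trans _ _ _ j).
    by apply: sij; rewrite in_arc; setlia.
  by apply: sjk; rewrite in_arc; setlia.
- move=> /andP[_ sik] jU; apply/andP; split; first by setlia.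
  apply: subset_trans sik; apply/subsetP => -[p q]; rewrite !in_arc.
  case: (eqVneq (q : nat) j) => [/ord_inj->|]; first by rewrite jU; setlia.
  by setlia.
- move=> /andP[_ sik] jU; apply/andP; split; first by setlia.
  apply: subset_trans sik; apply/subsetP => -[p q]; rewrite !in_arc.
  case: (eqVneq (p : nat) j) => [/ord_inj->|]; first by rewrite (negPf jU); setlia.
  by setlia.
Qed.

Lemma arc_sub_camb U (c : camb_A n U) i k : (i, k) \in camb_set c ->
  arc_set i k U \subset camb_set c.
Proof.
have /in_AP[_ _ lc rc] := camb_setP c.
move=> ik; apply/subsetP => -[p q]; rewrite in_arc => /and5P[ip pq qk pU qU].
have iq : (i, q) \in camb_set c.
  move: qU; case: eqP => [/ord_inj-> //|/= nqk qU].
  by apply: lc ik qU; setlia.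
move: pU; case: eqP => [/ord_inj-> //|/= npi pU].
by apply: rc iq _; rewrite ?inE //; setlia.
Qed.

Lemma camb_clopen U (c : camb_A n U) : is_clopen (camb_set c).
Proof.
have /in_AP[sc tc lc rc] := camb_setP c.
apply/is_clopenP; split=> // i j k ijk ik.
have [jU|jU] := boolP (j \in U); first by rewrite (lc i j k).
by rewrite (rc i j k) ?orbT ?inE.
Qed.

Definition camb_perm U (c : camb_A n U) := Permutohedron (camb_clopen c).

Lemma le_pi_U U (c : camb_A n U) x : (c <= pi_U U x)%O = (camb_perm c <= x)%O.
Proof.
have /andP[sx /forallP lx] := pi_U_largest U x.
apply/idP/idP => [|cx]; last exact: (implyP (lx c)).
by rewrite camb_leE perm_leE => /subset_trans; apply.
Qed.

Lemma camb_perm_pi_U_le U x : (camb_perm (pi_U U x) <= x)%O.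
Proof. by rewrite -le_pi_U. Qed.

Lemma pi_U_mono U x y : (x <= y)%O -> (pi_U U x <= pi_U U y)%O.
Proof. by rewrite le_pi_U; apply/le_trans/camb_perm_pi_U_le. Qed.

Lemma in_pi_U U x i k : ((i, k) \in camb_set (pi_U U x)) =
  (i < k) && (arc_set i k U \subset inversions x).
Proof.
apply/idP/andP => [ik|[ik sik]].
  have /in_AP[lt _ _ _] := camb_setP (pi_U U x); split; first exact: lt.
  apply: subset_trans (camb_perm_pi_U_le U x); exact: arc_sub_camb.
suff : (CambA (pi_set_in_A U x) <= pi_U U x)%O.
  by move=> /subsetP; apply; rewrite inE /= ik.
rewrite le_pi_U; apply/subsetP => -[p q]; rewrite inE /= => /andP[pq /subsetP].
by apply; rewrite in_arc; setlia.
Qed.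

Lemma pi_U_camb_perm U (c : camb_A n U) : pi_U U (camb_perm c) = c.
Proof.
apply/le_anti/andP; split; last by rewrite le_pi_U.
exact: (camb_perm_pi_U_le U (camb_perm c)).
Qed.

Lemma pi_U_meet U x y : pi_U U (x `&` y)%O = (pi_U U x `&` pi_U U y)%O.
Proof.
apply/le_anti/andP; split; first by rewrite lexI !pi_U_mono ?leIl ?leIr.
by rewrite le_pi_U lexI -!le_pi_U leIl leIr.
Qed.

(* The largest element of the fibre of [pi_U U] through x. *)
Definition fibre_top U x := perm_compl (camb_perm (pi_U (~: U) (perm_compl x))).

Lemma le_fibre_top U x : (x <= fibre_top U x)%O.
Proof.
rewrite -[leLHS]perm_complK /fibre_top.
by rewrite [(_ <= _)%O]perm_le_compl; apply: camb_perm_pi_U_le.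
Qed.

Lemma fibre_top_mono U x y : (x <= y)%O -> (fibre_top U x <= fibre_top U y)%O.
Proof.
move=> xy; rewrite [(_ <= _)%O]perm_le_compl.
by apply: pi_U_mono; rewrite [(_ <= _)%O]perm_le_compl.
Qed.

Lemma in_fibre_top U x i k : (i, k) \in inversions (fibre_top U x) ->
  exists p q, (p, q) \in arc_set i k (~: U) /\ (p, q) \in inversions x.
Proof.
rewrite !inE in_pi_U /= => /andP[+ ik]; rewrite ik /= => /subsetPn[[p q] pq].
rewrite !inE /= negb_and negbK => pqx; exists p, q; split=> //.
by case/orP: pqx => //; move: pq; rewrite in_arc; setlia.
Qed.

Lemma pi_U_fibre_top U x : pi_U U (fibre_top U x) = pi_U U x.
Proof.
apply/le_anti/andP; split; last exact/pi_U_mono/le_fibre_top.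
apply/subsetP => -[i k]; rewrite !in_pi_U => /andP[ik sik]; rewrite ik /=.
apply/subsetP => -[p q] pqA.
have {sik pqA} : p < q /\ arc_set p q U \subset inversions (fibre_top U x).
  split; first by move: pqA; rewrite in_arc; setlia.
  apply: subset_trans sik; apply/subsetP => -[r s]; move: pqA; rewrite !in_arc.
  case: (eqVneq (r : nat) p) => [/ord_inj->|?];
  case: (eqVneq (s : nat) q) => [/ord_inj->|?]; setlia.
case=> pq sub; have [m] := ubnP (q - p).
elim: m => // m IHm in p q pq sub *; move=> le_m.
have IH r s : (r, s) \in arc_set p q U -> s - r < q - p ->
    (r, s) \in inversions x.
  move=> rs lt; apply: IHm; last by setlia.
    by move: rs; rewrite in_arc; setlia.
  apply: subset_trans sub; apply/subsetP => -[u v]; move: rs; rewrite !in_arc.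
  case: (eqVneq (u : nat) r) => [/ord_inj->|?];
  case: (eqVneq (v : nat) s) => [/ord_inj->|?]; setlia.
(* Here r is p or in U, and s is q or outside U. So (p, r) and (s, q), when nontrivial, are shorter
   pairs of the arc for U; they lie in x by induction and compose with (r, s). *)
have [|r [s [rsA rsx]]] := @in_fibre_top U x p q.
  by apply: (subsetP sub); rewrite in_arc; setlia.
move: rsA; rewrite in_arc !inE negbK => rsA.
have ps : (p, s) \in inversions x.
  have [/ord_inj<- //|nrp] := eqVneq (r : nat) p.
  by apply: inversions_trans rsx; apply: IH; rewrite ?in_arc; setlia.
have [/ord_inj<- //|nsq] := eqVneq (s : nat) q.
by apply: inversions_trans ps _; apply: IH; rewrite ?in_arc; setlia.
Qed.

(** This is dual to [pi_U_fibre_top]: for the complement of U, the top of the fibre through the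
    complement of x is the complement of [pi_U U x]. *)
Lemma fibre_top_pi_U U x : fibre_top U (camb_perm (pi_U U x)) = fibre_top U x.
Proof.
rewrite /fibre_top; congr (perm_compl (camb_perm _)).
rewrite -[RHS]pi_U_fibre_top /fibre_top perm_complK.
by rewrite setCK.
Qed.

(** Both x and y lie below the top of the fibre over c, and that top projects to c. *)
Lemma pi_U_join U x y : pi_U U (x `|` y)%O = (pi_U U x `|` pi_U U y)%O.
Proof.
apply/le_anti/andP; split; last by rewrite leUx !pi_U_mono ?leUl ?leUr.
set c := (pi_U U x `|` pi_U U y)%O.
rewrite -[leRHS](pi_U_camb_perm c) -[leRHS]pi_U_fibre_top; apply: pi_U_mono.
have top z : (pi_U U z <= c)%O -> (z <= fibre_top U (camb_perm c))%O.
  move=> zc; apply: le_trans (le_fibre_top U z) _.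
  by rewrite -fibre_top_pi_U; apply: fibre_top_mono.
rewrite leUx; apply/andP; split; apply: top; first exact: leUl.
exact: leUr.
Qed.

Lemma kernel_pi_U_congruence U : is_congruence (kernel (pi_U U)).
Proof.
apply/and3P; split.
- apply/is_equivalenceP; split=> [x|x y|x y z]; rewrite !inE //= 1?eq_sym //.
  by move=> /eqP-> /eqP->.
- by apply/is_compatibleP => x1 x2 y1 y2; rewrite !inE /= !pi_U_meet => /eqP-> /eqP->.
- by apply/is_compatibleP => x1 x2 y1 y2; rewrite !inE /= !pi_U_join => /eqP-> /eqP->.
Qed.

End Projection.

(** * Comparison of the Cambrian congruence with the kernel *)

Section CambrianCongruence.

Context {n : nat} (U : {set 'I_n}).
Implicit Types (S : {set 'I_n}) (x : permutohedron n).
Notation eta := (cambrian_congruence U).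

(** The two sides differ only in (i, k). This pair is not in [pi_U U y], since its arc for U
    contains (i, j) or (j, k), whichever is absent from y. *)
Lemma cambrian_pairs_kernel : cambrian_pairs U \subset kernel (pi_U U).
Proof.
apply/subsetP => -[x y]; rewrite !inE /=.
move=> /existsP[i /existsP[j /existsP[k /and3P[/eqP ji /eqP ki xy]]]].
have ik : (i, k) \notin camb_set (pi_U U y).
  apply/negP; rewrite in_pi_U => /andP[_ /subsetP sub]; move: xy; case: ifP => jU.
    move=> /andP[_ /eqP y2]; have := sub (i, j); rewrite in_arc y2 !inE jU.
    by rewrite !xpair_eqE -!val_eqE /=; setlia.
  move=> /andP[_ /eqP y2]; have := sub (j, k); rewrite in_arc y2 !inE jU.
  by rewrite !xpair_eqE -!val_eqE /=; setlia.
have [sxy sy] : inversions x \subset inversions y /\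
    inversions y \subset (i, k) |: inversions x.
  by move: xy; case: ifP => _ /andP[/eqP-> /eqP->];
    rewrite subsetUl setUC subxx.
rewrite eq_le pi_U_mono //= le_pi_U perm_leE; apply/subsetP => p py.
have /subsetP/(_ _ py) := camb_perm_pi_U_le U y.
move/(subsetP sy); rewrite in_setU1 => /orP[/eqP pik|//].
by rewrite -pik py in ik.
Qed.

Lemma cambrian_sub_kernel : cambrian_congruence U \subset kernel (pi_U U).
Proof. exact: con_gen_min (kernel_pi_U_congruence U) cambrian_pairs_kernel. Qed.

Lemma cambrian_arc_step S (i j k : 'I_n) : j = i.+1 :> nat -> k = i.+2 :> nat ->
  (j \in S) != (j \in U) -> (arc_low i k S, arc i k S) \in con_graph eta.
Proof.
move=> ji ki jSU; apply: (subsetP (sub_con_gen _)); rewrite inE.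
apply/existsP; exists i; apply/existsP; exists j; apply/existsP; exists k.
rewrite ji ki !eqxx /=; case: ifP jSU => jU jS.
  apply/andP; split; apply/eqP/setP => -[p q];
  rewrite ?in_setD1 in_arc !inE !xpair_eqE -!val_eqE /=;
  case: (eqVneq (p : nat) j) => [/ord_inj->|?];
  case: (eqVneq (q : nat) j) => [/ord_inj->|?]; setlia.
apply/andP; split; apply/eqP/setP => -[p q];
rewrite ?in_setD1 in_arc !inE !xpair_eqE -!val_eqE /=;
case: (eqVneq (p : nat) j) => [/ord_inj->|?];
case: (eqVneq (q : nat) j) => [/ord_inj->|?]; setlia.
Qed.

Lemma cambrian_arc S (a j b : 'I_n) : a < j < b -> (j \in S) != (j \in U) ->
  (arc_low a b S, arc a b S) \in con_graph eta.
Proof.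
move=> ajb jSU.
(* As a < j < b, the predecessor is genuine, and j - 1 and j + 1 stay within the range from a to
   b. *)
have lti : j.-1 < n by apply: leq_ltn_trans (ltn_ord j); setlia.
have ltk : j.+1 < n by apply: leq_ltn_trans (ltn_ord b); setlia.
apply: (@arc_contract _ _ _ _ (Ordinal lti) (Ordinal ltk)) => /=; try setlia.
by apply: cambrian_arc_step jSU => /=; setlia.
Qed.

Lemma cambrian_pi_U x : (camb_perm (pi_U U x), x) \in con_graph eta.
Proof.
have [m pim max_m] := con_class_max eta (camb_perm (pi_U U x)).
have pi_le := camb_perm_pi_U_le U x.
suff xm : (x <= m)%O by apply: con_convex xm pim.
have /is_clopenP[ltx _ _] := inversionsP x.
apply/subsetP => -[a b] abx; have [l] := ubnP (b - a).
elim: l => // l IHl in a b abx *; move=> le_l.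
pose S := [set j | (a, j) \in inversions x].
have JS : arc_set a b S \subset inversions x.
  by apply: arc_sub => // j _; rewrite inE.
have ab : a < b := ltx _ _ abx.
have abJ : (a, b) \in arc_set a b S by rewrite in_arc; setlia.
have lowm : (arc_low a b S <= m)%O.
  apply/subsetP => -[p q]; rewrite in_setD1 xpair_eqE -!val_eqE /= => /andP[ne pq].
  apply: IHl; first exact: (subsetP JS).
  by move: pq; rewrite in_arc; setlia.
have [/existsP[j /andP[ajb jSU]]|eqSU] :=
  boolP [exists j : 'I_n, (a < j < b) && ((j \in S) != (j \in U))].
  (* Joining with m absorbs the lower cover, so m is congruent to its join with the arc; maximality
     of m puts the arc below m. *)
  have := con_join (cambrian_arc ajb jSU) (con_refl eta m).
  rewrite (join_r lowm) => /(con_trans pim)/max_m.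
  by rewrite leUx => /andP[/subsetP + _]; apply.
apply: (subsetP (max_m _ (con_refl _ _))) => /=.
rewrite in_pi_U ab /=; apply: arc_sub => // j ajb.
move: eqSU; rewrite negb_exists => /forallP/(_ j).
by rewrite ajb /= negbK inE => /eqP.
Qed.

Lemma cambrian_eq_kernel :
  cambrian_congruence U = kernel (pi_U U) :> {set permutohedron n * permutohedron n}.
Proof.
apply/eqP; rewrite eqEsubset cambrian_sub_kernel /=.
apply/subsetP => -[x y]; rewrite inE /= => /eqP xy.
apply: con_trans (con_sym (cambrian_pi_U x)) _.
by rewrite xy; apply: cambrian_pi_U.
Qed.

(** * The induced isomorphism from the Cambrian lattice onto A_U(n) *)

Definition camb_iso (q : cambrian_lattice U) : camb_A n U := pi_U U (repr q).

Lemma camb_isoE x : camb_iso (\pi_(cambrian_lattice U) x) = pi_U U x.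
Proof.
apply/eqP; have := con_repr (cambrian_congruence U) x.
by rewrite cambrian_eq_kernel inE.
Qed.

Lemma camb_iso_meet : {morph camb_iso : p q / (p `&` q)%O}.
Proof.
elim/quotW => x; elim/quotW => y.
by rewrite [(_ `&` _)%O](quo_meetE (cambrian_congruence U)) !camb_isoE pi_U_meet.
Qed.

Lemma camb_iso_join : {morph camb_iso : p q / (p `|` q)%O}.
Proof.
elim/quotW => x; elim/quotW => y.
by rewrite [(_ `|` _)%O](quo_joinE (cambrian_congruence U)) !camb_isoE pi_U_join.
Qed.

Lemma camb_iso_le : {homo camb_iso : p q / (p <= q)%O}.
Proof. by move=> p q /meet_l pq; rewrite -pq camb_iso_meet leIr. Qed.

HB.instance Definition _ := Order.isOrderMorphism.Build _ (cambrian_lattice U)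
  _ (camb_A n U) camb_iso camb_iso_le.
HB.instance Definition _ := Order.isLatticeMorphism.Build _ (cambrian_lattice U)
  _ (camb_A n U) camb_iso camb_iso_meet camb_iso_join.

Lemma camb_iso_bij : bijective camb_iso.
Proof.
exists (fun c => \pi_(cambrian_lattice U) (camb_perm c)); last first.
  by move=> c; rewrite camb_isoE pi_U_camb_perm.
elim/quotW => x; rewrite camb_isoE; apply/quo_eqP; exact: cambrian_pi_U.
Qed.

End CambrianCongruence.

Theorem proposition6p9 (n : nat) (hn : 2 <= n) (U : {set 'I_n})
    (hU : forall u : 'I_n, u \in U -> 0 < u < n.-1) :
  cambrian_congruence U = kernel (pi_U U) :> {set permutohedron n * permutohedron n} /\
  exists f : {lmorphism cambrian_lattice U -> camb_A n U},
    bijective f /\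
    forall x : permutohedron n, f (\pi_(cambrian_lattice U) x) = pi_U U x.
Proof.
split; first exact: cambrian_eq_kernel.
exists (camb_iso (U := U)); split; first exact: camb_iso_bij.
exact: camb_isoE.
Qed.
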